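(* For any finite set $\mathcal{A}\subset\mathbb{R}$, the pair $\left(1,1-\frac{1}{2^{C(\mathcal{A})}}\right)$ is $\mathcal{A}$-feasible.
   Context: Protocols. Let $\mathcal{A}\subset\mathbb{R}$ be finite. An $\mathcal{A}$-protocol with parameters $(k,n,\ell)$ (positive integers, $n\ge k$) consists of a linear encoding $\mathbb{R}^k\to\mathbb{R}^n$, $\mathbf{x}\mapsto\mathbf{y}=(y_1,\dots,y_n)$ (each $y_i$ is a fixed linear combination of the entries of $\mathbf{x}$ and is stored on server $i$), together with, for every $\mathbf{w}\in\mathcal{A}^k$, a set $S_{\mathbf{w}}\subseteq[n]$ of at most $\ell$ servers (depending only on $\mathbf{w}$) and a decoding function that for every $\mathbf{x}\in\mathbb{R}^k$ computes $\mathbf{w}\mathbf{x}^\intercal$ from $(y_i)_{i\in S_{\mathbf{w}}}$. Feasibility. A pair $(\alpha,\beta)\in\mathbb{R}^2$ is $\mathcal{A}$-feasible if there is an infinite family of $\mathcal{A}$-protocols with parameters $\{(k_i,n_i,\ell_i)\}_{i\ge0}$, with $k_i$ strictly increasing, such that $\lim_{i\to\infty}(n_i/k_i,\ell_i/k_i)=(\alpha,\beta)$. Complexity. For a finite set $\mathcal{A}\subset\mathbb{R}$, the complexity $C(\mathcal{A})$ is the smallest positive integer $\theta$ for which there exist (not necessarily distinct) real numbers $x_1,\dots,x_\theta,y_1,\dots,y_\theta$ with $\mathcal{A}\subseteq\{x_1,y_1\}+\cdots+\{x_\theta,y_\theta\}$, where $+$ denotes the sumset $\mathcal{S}+\mathcal{T}=\{s+t\mid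 s\in\mathcal{S},t\in\mathcal{T}\}$. *)

(* Defs.v *)
From mathcomp Require Import all_boot all_order all_algebra finmap.
From mathcomp Require Import all_classical all_reals all_analysis.

Set Implicit Arguments.
Unset Strict Implicit.
Unset Printing Implicit Defensive.

Import Order.TTheory GRing.Theory Num.Theory.
Import numFieldNormedType.Exports.

Local Open Scope classical_set_scope.
Local Open Scope ring_scope.

(* Only the values of [servers] and [decoding] at coefficient vectors [w] with
   entries in [A] are constrained; elsewhere they are junk.  The argument of
   [decoding w] is a family of reals indexed by the servers of [servers w], so
   the decoder sees no other stored symbol. *)
Record protocol (R : realType) (A : {fset R}) (k n l : nat) := Protocol {
  encoding : {linear 'rV[R]_k -> 'rV[R]_n};
  servers : 'rV[R]_k -> {set 'I_n};
  decoding : forall w : 'rV[R]_k, ({i : 'I_n | i \in servers w} -> R) -> R;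
  protocol_k_gt0 : (0 < k)%N;
  protocol_l_gt0 : (0 < l)%N;
  protocol_k_le_n : (k <= n)%N;
  protocol_card_servers : forall w : 'rV[R]_k,
    (forall j, w 0 j \in A) -> (#|servers w| <= l)%N;
  protocol_decodingP : forall w : 'rV[R]_k, (forall j, w 0 j \in A) ->
    forall x : 'rV[R]_k,
      @decoding w (fun i => encoding x 0 (val i)) = (w *m x^T) 0 0
}.

Definition feasible (R : realType) (A : {fset R}) (alpha beta : R) : Prop :=
  exists (k n l : nat -> nat) (P : forall i, protocol A (k i) (n i) (l i)),
    {homo k : i j / (i < j)%N} /\
    ((n i)%:R / (k i)%:R : R, (l i)%:R / (k i)%:R : R) @[i --> \oo]
      --> (alpha, beta).

Definition sumset (R : realType) (S T : set R) : set R :=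
  [set s + t | s in S & t in T].

(* The neutral element [set 0] of [sumset] ends the iterated sumset. *)
Definition covered_by_pairs (R : realType) (A : {fset R}) (theta : nat) : Prop :=
  exists x y : 'I_theta -> R,
    [set` A] `<=` \big[@sumset R/[set 0]]_(j < theta) [set x j; y j].

(* Witness: the pairs {0, a} for a in A, plus one pair {0, 0} so that there is
   at least one pair when A is empty. *)
Lemma complexity_subproof (R : realType) (A : {fset R}) :
  exists theta, (0 < theta)%N && `[< covered_by_pairs A theta >].
Proof.
have H (s : seq R) z : z \in 0 :: s ->
    (\big[@sumset R/[set 0]]_(j < size s) [set 0; s`_j]) z.
  elim: s z => [|a s IH] z; first by rewrite inE big_ord0 => /eqP.
  rewrite big_ord_recl !inE orbCA => /orP[/eqP ->|zs].
    by exists a; [right|exists 0; [exact/IH/mem_head|rewrite addr0]].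
  by exists 0; [left|exists z; [apply: IH; rewrite inE|rewrite add0r]].
exists (size (0 :: enum_fset A)); apply/andP; split=> //; apply/asboolP.
exists (fun=> 0), (fun j => (0 :: enum_fset A)`_j) => z zA.
by apply: (H (0 :: enum_fset A)); rewrite 2!in_cons; apply/orP; right; apply/orP; right.
Qed.

Definition complexity (R : realType) (A : {fset R}) : nat :=
  ex_minn (complexity_subproof A).

(* Main.v *)
(** Since [A] is contained in a sum of [C(A)] pairs, it has at most [2 ^ C(A)]
    elements.  Take [k = 2 ^ C(A) * N] and store the [k] entries of [x] together
    with their sum.  By pigeonhole some value [a] occurs at least [N] times in
    [w], and [w x = a (sum_j x_j) + sum_j (w_j - a) x_j] only reads the sum and
    the at most [k - N] entries [x_j] with [w_j <> a]. *)
Require Import Defs.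
From mathcomp Require Import all_boot all_order all_algebra finmap.
From mathcomp Require Import all_classical all_reals all_analysis.

Set Implicit Arguments.
Unset Strict Implicit.
Unset Printing Implicit Defensive.

Import Order.TTheory GRing.Theory Num.Theory.
Import numFieldNormedType.Exports.

Local Open Scope ring_scope.

(** Repetitions are kept in [s]: each pair exactly doubles the length, even when its two elements
    coincide. The size is then an exact power of two, which the final limit relies on. *)
Lemma bigsumset_pairs_seq (R : realType) (theta : nat) (x y : 'I_theta -> R) :
  exists2 s : seq R, size s = (2 ^ theta)%N &
    (\big[@sumset R/[set 0]]_(j < theta) [set x j; y j] `<=` [set` s])%classic.
Proof.
elim: theta x y => [|theta IH] x y.
  by exists [:: 0] => // z; rewrite big_ord0 /= inE => ->.
have [s ss sub] := IH (x \o lift ord0) (y \o lift ord0).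
exists ([seq x ord0 + t | t <- s] ++ [seq y ord0 + t | t <- s]).
  by rewrite size_cat !size_map ss expnS mul2n addnn.
move=> z; rewrite big_ord_recl => -[u uxy [t /sub /= ts <-]].
rewrite /= mem_cat; apply/orP.
by case: uxy => ->; [left|right]; apply: map_f.
Qed.

Lemma pigeonhole_seq (I : finType) (T : eqType) (f : I -> T) (s : seq T)
    (N : nat) :
  (0 < #|I|)%N -> (forall i, f i \in s) -> (size s * N <= #|I|)%N ->
  exists a, (N <= #|[set i | f i == a]|)%N.
Proof.
move=> I0 fs sN; apply: contrapT => noa.
have lt a : (#|[set i | f i == a]| < N)%N.
  by rewrite ltnNge; apply/negP => ?; apply: noa; exists a.
(* Every [i] is counted at least once, at the value [f i]; duplicates in [s] only enlarge the
   sum. *)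
have cardI : (#|I| <= \sum_(a <- s) #|[set i | f i == a]|)%N.
  under eq_bigr do rewrite -sum1dep_card big_mkcond.
  rewrite exchange_big -sum1_card; apply: leq_sum => i _.
  by rewrite (big_rem (f i)) ?fs //= eqxx.
have s0 : (0 < size s)%N.
  by case/card_gt0P: I0 => i _; case: (s) (fs i).
have N0 : (0 < N)%N.
  by case/card_gt0P: I0 => i _; apply: leq_ltn_trans (lt (f i)).
suff : (#|I| <= size s * N.-1)%N.
  by rewrite leqNgt (leq_trans _ sN)// ltn_pmul2l// prednK.
apply: (leq_trans cardI); rewrite -sum1_size big_distrl /=.
by apply: leq_sum => a _; rewrite mul1n -ltnS prednK.
Qed.

(** If [G *m c^T = w^T], then [w *m x^T = c *m (x *m G)^T], so [w] can be decoded from the servers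
    in the support of [c] alone. *)
Lemma protocol_of_matrix (R : realType) (A : {fset R}) (k n l : nat)
    (G : 'M[R]_(k, n)) :
  (0 < k)%N -> (0 < l)%N -> (k <= n)%N ->
  (forall w : 'rV[R]_k, (forall j, w 0 j \in A) ->
    exists2 c : 'rV[R]_n, G *m c^T = w^T &
      (#|[set i | (c 0 i != 0)%R]| <= l)%N) ->
  protocol A k n l.
Proof.
move=> k0 l0 kn cP.
(* Servers and decoder may depend on [w] but not on [x], so one [c] is fixed for each [w]; it
   defaults to 0 when some entry of [w] is outside [A]. *)
have /choice[c {}cP] (w : 'rV[R]_k) : exists c : 'rV[R]_n,
    (forall j, w 0 j \in A) ->
    G *m c^T = w^T /\ (#|[set i | (c 0 i != 0)%R]| <= l)%N.
  have [/cP[c Gc cl]|nA] := pselect (forall j, w 0 j \in A); first by exists c.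
  by exists 0 => /nA.
pose S w := [set i | c w 0 i != 0].
pose dec w (y : {i | i \in S w} -> R) := \sum_i c w 0 (val i) * y i.
apply: (@Protocol R A k n l (mulmxr G) S dec) => // w wA => [|x].
  by have [] := cP w wA.
have [Gc _] := cP w wA.
have -> : w *m x^T = c w *m (x *m G)^T.
  by rewrite trmx_mul mulmxA -[c w *m _]trmxK trmx_mul trmxK Gc trmxK.
rewrite mxE; transitivity (\sum_(i in S w) c w 0 i * (x *m G) 0 i).
  exact: esym (big_sub (S w) (fun i => c w 0 i * (x *m G) 0 i)).
rewrite big_mkcond; apply: eq_bigr => i _.
by rewrite [in RHS]mxE inE; case: eqP => //= ->; rewrite mul0r.
Qed.

Lemma protocol_pigeonhole (R : realType) (A : {fset R}) (s : seq R) (N : nat) :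
  (0 < size s)%N -> (0 < N)%N -> {subset A <= s} ->
  protocol A (size s * N) (size s * N + 1) ((size s).-1 * N + 1).
Proof.
set k := (size s * N)%N => s0 N0 As.
have k0 : (0 < k)%N by rewrite muln_gt0 s0.
(* Server [j < k] stores the entry [x_j], and the last server stores the sum of all entries. *)
apply: (protocol_of_matrix (G := row_mx 1%:M (const_mx 1))) => //.
- by rewrite addn1.
- by rewrite leq_addr.
move=> w wA.
have [||a aN] := @pigeonhole_seq 'I_k _ (w 0) s N _ (fun j => As _ (wA j)).
- by rewrite card_ord.
- by rewrite card_ord.
exists (row_mx (w - const_mx a) (const_mx a)).
  rewrite tr_row_mx mul_row_col mul1mx linearB /=; apply/matrixP => i j.
  by rewrite !mxE big_ord1 !mxE mul1r subrK.
(* The server of the sum is counted even if [a = 0], whence the [+ 1]; the others are the at most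
   [k - N = (size s).-1 * N] positions where [w] differs from [a]. *)
have sub : [set i | row_mx (w - const_mx a) (const_mx a : 'rV_1) 0 i != 0]
   \subset (rshift k ord0 |: (lshift 1 @: ~: [set j | w 0 j == a])).
  apply/fintype.subsetP => i; rewrite !inE.
  case: (split_ordP i) => j ->; last by rewrite ord1 eqxx.
  rewrite row_mxEl !mxE subr_eq0 => wja; apply/orP; right.
  by apply/imset_f; rewrite !inE.
apply: (leq_trans (subset_leq_card sub)).
apply: (leq_trans (leq_card_setU _ _)); rewrite cards1 addnC leq_add2r.
apply: (leq_trans (leq_imset_card _ _)); rewrite cardsCs finset.setCK card_ord.
by rewrite -subn1 mulnBl mul1n leq_sub2l.
Qed.

Lemma complexity_seq (R : realType) (A : {fset R}) :
  exists2 s : seq R, size s = (2 ^ complexity A)%N & {subset A <= s}.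
Proof.
rewrite /complexity; case: ex_minnP => theta /andP[_ /asboolP[x [y Axy]]] _.
have [s ss sub] := bigsumset_pairs_seq x y.
by exists s => // z zA; exact/sub/Axy.
Qed.

Theorem proposition13 (R : realType) (A : {fset R}) :
  feasible A 1 (1 - 1 / 2 ^+ complexity A).
Proof.
have [s ss As] := complexity_seq A.
have s0 : (0 < size s)%N by rewrite ss expn_gt0.
(* Taking [N = i.+1] keeps [N] positive from [i = 0] on. *)
exists (fun i => size s * i.+1)%N, (fun i => size s * i.+1 + 1)%N,
  (fun i => (size s).-1 * i.+1 + 1)%N.
exists (fun i => protocol_pigeonhole s0 (ltn0Sn i) As).
split=> [i j ij|]; first by rewrite ltn_pmul2l.
have s0R : (size s)%:R != 0 :> R by rewrite pnatr_eq0 -lt0n.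
have i0R i : i.+1%:R != 0 :> R by rewrite pnatr_eq0.
(* Both ratios are their limit plus the contribution [1 / (size s * i.+1)] of the single extra
   server. *)
have cvg_perturb (c : R) :
    (c + (size s)%:R^-1 * harmonic i @[i --> \oo] --> c)%classic.
  have : ((size s)%:R^-1 * harmonic i @[i --> \oo] --> (0 : R))%classic.
    rewrite -(mulr0 (size s)%:R^-1).
    by apply: cvgM; [exact: cvg_cst|exact: cvg_harmonic].
  by move=> /(cvgD (cvg_cst c)); rewrite addr0.
apply: (cvg_pair (G := nbhs (1 : R))
  (H := nbhs (1 - 1 / 2 ^+ complexity A : R))) => /=.
  have -> : (fun i => (size s * i.+1 + 1)%:R / (size s * i.+1)%:R : R) =
            (fun i => 1 + (size s)%:R^-1 * harmonic i).
    apply/funext => i; rewrite natrD mulrDl divff ?natrM ?mulf_neq0//.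
    by rewrite mul1r invfM.
  exact: cvg_perturb.
have -> : (fun i => ((size s).-1 * i.+1 + 1)%:R / (size s * i.+1)%:R : R) =
          (fun i => 1 - (size s)%:R^-1 + (size s)%:R^-1 * harmonic i).
  apply/funext => i; rewrite natrD mulrDl !natrM -mulf_div divff// mulr1 mul1r.
  by rewrite invfM -subn1 natrB// mulrBl divff// mul1r.
by rewrite div1r -natrX -ss; exact: cvg_perturb.
Qed.
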